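(* Let $\Gamma$ be a finite simplicial graph with at least three vertices, and let $A(\Gamma)$ be the associated right-angled Artin group. Then $\Gamma$ is biconnected if and only if $A(\Gamma)$ does not split over $\mathbb{Z}$.
   Context: For a finite simplicial graph $\Gamma$ with vertex set $\Gamma^0$, the right-angled Artin group is $A(\Gamma)=\langle \Gamma^0 \mid [v,w]=1 \text{ whenever } v,w \text{ span an edge of } \Gamma\rangle$. A graph $\Gamma$ is biconnected if it is connected and, for every vertex $v$, the induced subgraph on $\Gamma^0-\{v\}$ is connected; in other words, $\Gamma$ is connected and has no cut vertex. A group $G$ splits over a subgroup $Z$ if $G=A\ast_Z B$ with $A\neq Z\neq B$, or $G=A\ast_Z$ is an HNN-extension. ''Splits over $\mathbb{Z}$'' means that $G$ splits over some subgroup isomorphic to $\mathbb{Z}$. *)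

(* Defs.v *)
(* groups are an
   explicit record, since possibly-infinite groups are not in MathComp. *)
From mathcomp Require Import all_boot all_algebra.
Set Implicit Arguments. Unset Strict Implicit. Unset Printing Implicit Defensive.

Record simple_graph := SimpleGraph {
  gvert :> finType;
  gadj : rel gvert;
  gadj_sym : symmetric gadj;
  gadj_irr : irreflexive gadj }.
Arguments gadj : clear implicits.

Definition connected_on (Gm : simple_graph) (S : {set Gm}) : Prop :=
  forall x y, x \in S -> y \in S ->
    connect (fun a b => [&& gadj Gm a b, a \in S & b \in S]) x y.

Definition graph_connected (Gm : simple_graph) : Prop :=
  connected_on [set: Gm].

Definition biconnected (Gm : simple_graph) : Prop :=
  graph_connected Gm /\ forall v : Gm, connected_on [set~ v].

Record group := Group {
  gcar :> Type;
  gmul : gcar -> gcar -> gcar;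
  gone : gcar;
  ginv : gcar -> gcar;
  gmulA : forall x y z, gmul x (gmul y z) = gmul (gmul x y) z;
  gmul1 : forall x, gmul gone x = x;
  gmulV : forall x, gmul (ginv x) x = gone }.

Arguments gmul {g}. Arguments gone {g}. Arguments ginv {g}.

Definition is_hom (G H : group) (f : G -> H) : Prop :=
  forall x y, f (gmul x y) = gmul (f x) (f y).

Definition hom_on (G H : group) (A : G -> Prop) (f : G -> H) : Prop :=
  forall x y, A x -> A y -> f (gmul x y) = gmul (f x) (f y).

Definition subgroup (G : group) (A : G -> Prop) : Prop :=
  [/\ A gone, (forall x y, A x -> A y -> A (gmul x y)) &
      (forall x, A x -> A (ginv x))].

Fixpoint npow (G : group) (x : G) (n : nat) : G :=
  if n is m.+1 then gmul x (npow x m) else gone.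

Definition zpow (G : group) (x : G) (z : int) : G :=
  match z with Posz n => npow x n | Negz n => ginv (npow x n.+1) end.

Definition infinite_cyclic (G : group) (C : G -> Prop) : Prop :=
  exists c : G, (forall x, C x <-> exists z : int, x = zpow c z) /\
                (forall z : int, zpow c z = gone -> z = 0%R).

(* G = A *_C B, internally: the inclusions A -> G, B -> G make G the
   pushout (amalgamated free product) of A <- C -> B. *)
Definition amalgam_of (G : group) (A B C : G -> Prop) : Prop :=
  subgroup A /\ subgroup B /\ subgroup C /\
  (forall x, C x -> A x /\ B x) /\
  forall (H : group) (fA fB : G -> H),
    hom_on A fA -> hom_on B fB -> (forall c, C c -> fA c = fB c) ->
    exists g : G -> H,
      [/\ is_hom g, (forall a, A a -> g a = fA a),
          (forall b, B b -> g b = fB b) &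
          forall g' : G -> H, is_hom g' -> (forall a, A a -> g' a = fA a) ->
            (forall b, B b -> g' b = fB b) -> forall x, g' x = g x].

(* G = A *_C, internally: A base, t stable letter with t c t^-1 in A for
   c in C (the associated isomorphism is conjugation by t), and G has the
   universal property of the HNN extension. *)
Definition hnn_of (G : group) (A C : G -> Prop) (t : G) : Prop :=
  subgroup A /\ subgroup C /\ (forall x, C x -> A x) /\
  (forall c, C c -> A (gmul t (gmul c (ginv t)))) /\
  forall (H : group) (f : G -> H) (h : H),
    hom_on A f ->
    (forall c, C c -> gmul h (gmul (f c) (ginv h)) = f (gmul t (gmul c (ginv t)))) ->
    exists g : G -> H,
      [/\ is_hom g, (forall a, A a -> g a = f a), g t = h &
          forall g' : G -> H, is_hom g' -> (forall a, A a -> g' a = f a) ->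
            g' t = h -> forall x, g' x = g x].

Definition splits_over_Z (G : group) : Prop :=
  (exists A B C : G -> Prop,
     [/\ amalgam_of A B C, infinite_cyclic C,
         ~ (forall x, A x -> C x) & ~ (forall x, B x -> C x)])
  \/ (exists (A C : G -> Prop) (t : G), hnn_of A C t /\ infinite_cyclic C).

(* (G, iota) is the right-angled Artin group A(Gm): it satisfies the
   universal property of the presentation <V | [v,w] = 1 for edges vw>. *)
Definition is_RAAG (Gm : simple_graph) (G : group) (iota : Gm -> G) : Prop :=
  (forall v w, gadj Gm v w -> gmul (iota v) (iota w) = gmul (iota w) (iota v)) /\
  forall (H : group) (f : Gm -> H),
    (forall v w, gadj Gm v w -> gmul (f v) (f w) = gmul (f w) (f v)) ->
    exists g : G -> H,
      [/\ is_hom g, (forall v, g (iota v) = f v) &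
          forall g' : G -> H, is_hom g' -> (forall v, g' (iota v) = f v) ->
            forall x, g' x = g x].

(* Main.v *)
(* If v is a cut vertex, then A(Gamma) is the amalgam over <v> of the special
   subgroups on the two sides of v.

   Conversely, a splitting of G over C yields a function mu : C\G -> {0,1}
   (the side of the Bass-Serre tree, relative to an edge, on which the base
   vertex lies) which is almost invariant, i.e. mu and its translates differ
   at finitely many points, but neither finite nor cofinite.  No tree is
   needed: the universal property of the splitting, applied to a semidirect
   product of G with functions G -> {0,1}, provides mu.
   When C is infinite cyclic, Gamma is biconnected and G = A(Gamma), such a mu
   can not exist.  Let F_v be the set of points with finite <v>-orbit; F_v and
   F_w are disjoint for v <> w, as v and w are independent in the abelianization.
   Off F_v, the limits of mu at the two ends of a <v>-orbit exist, and coincide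
   because v has two neighbours.  Hence the limit mu_v along <v>-orbits is a
   v-invariant function that differs from mu at finitely many points.  For
   adjacent v and w, mu_v = mu_w off the union of F_v and F_w; as Gamma and all
   Gamma - z are connected, the mu_v glue to a single G-invariant, hence
   constant, function nu with nu = mu_v off F_v. *)
Require Import Defs.
From mathcomp Require Import all_boot all_algebra.
From mathcomp Require Import boolp classical_sets functions cardinality.
From mathcomp Require Import zify.
Set Implicit Arguments. Unset Strict Implicit. Unset Printing Implicit Defensive.
Import GRing.Theory.

Declare Scope grp_scope.
Delimit Scope grp_scope with grp.
Local Open Scope grp_scope.
Notation "x ** y" := (gmul x y) (at level 40, left associativity) : grp_scope.
Notation "x ^V" := (ginv x) (at level 2, left associativity, format "x ^V") : grp_scope.
Notation "x ^^ z" := (zpow x z) (at level 30, right associativity) : grp_scope.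

(** * Groups and integer powers *)

Section GroupTheory.
Variable G : group.
Implicit Types (x y z : G) (i j : int) (P : G -> Prop).

Lemma gmulKV x y : x^V ** (x ** y) = y.
Proof. by rewrite gmulA gmulV gmul1. Qed.

Lemma gmulVr x : x ** x^V = gone.
Proof. by rewrite -[LHS](gmulKV x^V) (gmulKV x) gmulV. Qed.

Lemma gmulr1 x : x ** gone = x.
Proof. by rewrite -(gmulV x) gmulA gmulVr gmul1. Qed.

Lemma gmulK x y : x ** (x^V ** y) = y.
Proof. by rewrite gmulA gmulVr gmul1. Qed.

Lemma gmulrK x y : y ** x ** x^V = y.
Proof. by rewrite -gmulA gmulVr gmulr1. Qed.

Lemma gmulrKV x y : y ** x^V ** x = y.
Proof. by rewrite -gmulA gmulV gmulr1. Qed.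

Lemma gmul_injl x y z : x ** y = x ** z -> y = z.
Proof. by move=> e; rewrite -(gmulKV x y) e gmulKV. Qed.

Lemma ginv_unique x y : x ** y = gone -> y = x^V.
Proof. by move=> e; apply: (@gmul_injl x); rewrite e gmulVr. Qed.

Lemma ginvK x : x^V ^V = x.
Proof. by apply/esym/ginv_unique/gmulV. Qed.

Lemma ginvM x y : (x ** y)^V = y^V ** x^V.
Proof. by apply/esym/ginv_unique; rewrite -gmulA gmulK gmulVr. Qed.

Lemma ginv1 : gone^V = gone :> G.
Proof. by apply/esym/ginv_unique/gmul1. Qed.

Lemma npowSr x n : npow x n.+1 = npow x n ** x.
Proof.
elim: n => [|n ih]; first by rewrite /= gmulr1 gmul1.
by rewrite -[LHS]/(x ** npow x n.+1) {1}ih gmulA.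
Qed.

Lemma zpowS x i : x ^^ (i + 1)%R = x ** x ^^ i.
Proof.
case: i => [n|[|n]].
- by have -> : (n%:Z + 1 = n.+1%:Z)%R by lia.
- have -> : (Negz 0 + 1 = 0%N%:Z)%R by lia.
  by rewrite /= gmulr1 gmulVr.
- have -> : (Negz n.+1 + 1 = Negz n)%R by lia.
  by rewrite /zpow (npowSr x n.+1) ginvM gmulK.
Qed.

Lemma zpowD x i j : x ^^ (i + j)%R = x ^^ i ** x ^^ j.
Proof.
elim/int_rect: i => [|n ih|n ih]; first by rewrite add0r gmul1.
- by rewrite -addn1 PoszD addrAC !zpowS ih gmulA.
- apply: (@gmul_injl x); rewrite -zpowS gmulA -zpowS.
  have -> : (- n.+1%:Z + j + 1 = - n%:Z + j)%R by lia.
  by have -> : (- n.+1%:Z + 1 = - n%:Z)%R by lia.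
Qed.

Lemma zpow1 x : x ^^ 1%R = x.
Proof. exact: gmulr1. Qed.

Lemma zpowN x i : x ^^ (- i)%R = (x ^^ i)^V.
Proof. by apply: ginv_unique; rewrite -zpowD subrr. Qed.

Lemma zpow_comm x y i : x ** y = y ** x -> x ^^ i ** y = y ** x ^^ i.
Proof.
move=> xy; elim/int_rect: i => [|n ih|n ih]; first by rewrite /= gmul1 gmulr1.
- by rewrite -addn1 PoszD addrC zpowD zpow1 -gmulA ih gmulA xy gmulA.
- apply: (@gmul_injl x); rewrite gmulA -zpowS gmulA xy -gmulA -zpowS.
  by have -> : (- n.+1%:Z + 1 = - n%:Z)%R by lia.
Qed.

Lemma zpow_comm2 x y i j : x ** y = y ** x -> x ^^ i ** y ^^ j = y ^^ j ** x ^^ i.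
Proof. by move=> xy; apply/zpow_comm/esym/zpow_comm. Qed.

Lemma subgroup_zpow P x i : subgroup P -> P x -> P (x ^^ i).
Proof.
case=> P1 PM PV Px; have Pn n : P (npow x n) by elim: n => //= n; apply: PM.
by case: i => n; [apply: (Pn n)|apply: (PV _ (Pn n.+1))].
Qed.

Lemma subgroup_mulr P x y : subgroup P -> P y -> P (x ** y) <-> P x.
Proof.
case=> _ PM PV Py; split=> [Pxy|Px]; last exact: PM.
by rewrite -(gmulrK y x); apply: PM => //; apply: PV.
Qed.

Definition gen P x := forall Q, subgroup Q -> (forall y, P y -> Q y) -> Q x.

Lemma gen_subgroup P : subgroup (gen P).
Proof.
split=> [Q [] //|x y hx hy Q sQ PQ|x hx Q sQ PQ]; case: (sQ) => _ QM QV.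
- exact: QM (hx Q sQ PQ) (hy Q sQ PQ).
- exact: QV (hx Q sQ PQ).
Qed.

Lemma gen_sub P x : P x -> gen P x.
Proof. by move=> Px Q _; apply. Qed.

End GroupTheory.
Arguments zpow : simpl never.

Lemma hom1 (G H : group) (f : G -> H) : is_hom f -> f gone = gone.
Proof. by move=> hf; apply: (@gmul_injl _ (f gone)); rewrite -hf !gmulr1. Qed.

Lemma homV (G H : group) (f : G -> H) x : is_hom f -> f x^V = (f x)^V.
Proof. by move=> hf; apply: ginv_unique; rewrite -hf gmulVr hom1. Qed.

Lemma hom_npow (G H : group) (f : G -> H) x n :
  is_hom f -> f (npow x n) = npow (f x) n.
Proof. by move=> hf; elim: n => [|n ih] /=; [rewrite hom1|rewrite hf ih]. Qed.

Lemma hom_zpow (G H : group) (f : G -> H) x i : is_hom f -> f (x ^^ i) = f x ^^ i.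
Proof. by move=> hf; case: i => n; rewrite /zpow ?(homV _ hf) (hom_npow _ _ hf). Qed.

Lemma hom_on1 (G H : group) (A : G -> Prop) (f : G -> H) :
  subgroup A -> hom_on A f -> f gone = gone.
Proof.
by case=> A1 _ _ hf; apply: (@gmul_injl _ (f gone)); rewrite -hf ?gmulr1.
Qed.

Lemma hom_onV (G H : group) (A : G -> Prop) (f : G -> H) x :
  subgroup A -> hom_on A f -> A x -> f x^V = (f x)^V.
Proof.
move=> sA hf Ax; case: (sA) => _ _ AV; apply: ginv_unique.
by rewrite -hf ?gmulVr ?(hom_on1 sA) //; apply: AV.
Qed.

(** The points of [A] where the two maps agree form a subgroup, so agreement on generators suffices.
    Membership in [A] is carried along because [f] is multiplicative only there. *)
Lemma hom_on_eq (G H : group) (A P : G -> Prop) (f g : G -> H) :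
  subgroup A -> hom_on A f -> is_hom g -> (forall x, A x -> gen P x) ->
  (forall x, P x -> A x) -> (forall x, P x -> g x = f x) ->
  forall x, A x -> g x = f x.
Proof.
move=> sA hf hg AP PA gf x Ax; case: (sA) => A1 AM AV.
suff [] : A x /\ g x = f x by [].
apply: (AP _ Ax (fun x => A x /\ g x = f x)); last by move=> y Py; split; auto.
split=> [|y z [Ay ey] [Az ez]|y [Ay ey]].
- by rewrite hom1 // (hom_on1 sA).
- by split; [apply: AM|rewrite hg hf // ey ez].
- by split; [apply: AV|rewrite homV // (hom_onV sA) // ey].
Qed.

(** * Subgroups as groups in their own right *)

Section Subgroup.
Variables (G : group) (P : G -> Prop) (sP : subgroup P).

Lemma sub_closed1 : P gone. Proof. by case: sP. Qed.
Lemma sub_closedM x y : P x -> P y -> P (x ** y). Proof. by case: sP => _ h _; apply: h. Qed.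
Lemma sub_closedV x : P x -> P x^V. Proof. by case: sP => _ _ h; apply: h. Qed.

Definition subg_group : group.
Proof.
apply: (@Defs.Group {x : G | P x}
  (fun x y => exist P (sval x ** sval y) (sub_closedM (svalP x) (svalP y)))
  (exist P gone sub_closed1)
  (fun x => exist P (sval x)^V (sub_closedV (svalP x)))).
- by move=> x y z; apply/eq_exist/gmulA.
- by case=> x Px; apply/eq_exist/gmul1.
- by move=> x; apply/eq_exist/gmulV.
Defined.

(** Total, with the junk value [gone] off [P], because the universal properties quantify over
    functions defined on all of [G]. *)
Definition to_subg (x : G) : subg_group :=
  if pselect (P x) is left Px then exist P x Px else gone.

Definition of_subg (x : subg_group) : G := sval x.

Lemma to_subgK x : P x -> of_subg (to_subg x) = x.
Proof. by rewrite /to_subg; case: pselect. Qed.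

Lemma to_subg_hom (A : G -> Prop) :
  (forall x, A x -> P x) -> subgroup A -> hom_on A to_subg.
Proof.
move=> AP [_ AM _] x y Ax Ay; rewrite /to_subg.
case: pselect => [px|]; last by case; apply/AP/AM.
case: pselect => [py|]; last by case; apply/AP.
by case: pselect => [pz|]; [apply: eq_exist|case; apply/AP].
Qed.

(** Turns the uniqueness clause of a universal property into an induction principle: the induced map
    into the subgroup, followed by the inclusion, has to be the identity. *)
Lemma subg_full (g : G -> subg_group) :
  (forall x, of_subg (g x) = x) -> forall x, P x.
Proof. by move=> gK x; rewrite -(gK x); apply: svalP. Qed.

End Subgroup.

(** * Almost invariant functions on a set with a group action *)

Lemma finite_int_bound (A : set int) :
  finite_set A -> exists N : nat, forall i, (N <= `|i|)%N -> ~ A i.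
Proof.
case/finite_seqP=> s ->; exists (\max_(i <- s) `|i|%N).+1 => i /= ltNi si.
by move: ltNi; apply/negP; rewrite -leqNgt; exact: (@leq_bigmax_seq _ _ xpredT absz i si isT).
Qed.


Section Action.
Variables (G : group) (E : Type) (act : G -> E -> E).
Hypothesis act1 : forall e, act gone e = e.
Hypothesis actM : forall g h e, act (g ** h) e = act g (act h e).
Implicit Types (a b g h : G) (e : E) (i j : int) (n : nat).

Lemma actC a b e : a ** b = b ** a -> act a (act b e) = act b (act a e).
Proof. by move=> ab; rewrite -!actM ab. Qed.

Lemma actKV g e : act g^V (act g e) = e.
Proof. by rewrite -actM gmulV act1. Qed.

Lemma act_zpowD a i j e : act (a ^^ (i + j)%R) e = act (a ^^ i) (act (a ^^ j) e).
Proof. by rewrite zpowD actM. Qed.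

Definition periodic a e := exists2 i : int, i <> 0%R & act (a ^^ i) e = e.

Lemma periodic_act a g e : a ** g = g ** a -> periodic a (act g e) <-> periodic a e.
Proof.
move=> ag; have agi i := zpow_comm i ag.
split=> -[i i0 fi]; exists i => //; last by rewrite (actC _ (agi i)) fi.
by rewrite -[LHS](actKV g) -(actC _ (agi i)) fi actKV.
Qed.

Lemma orbit_inj a e i j :
  ~ periodic a e -> act (a ^^ i) e = act (a ^^ j) e -> i = j.
Proof.
move=> nper eij; apply: contrapT => nij; apply: nper; exists (- j + i)%R; first lia.
by rewrite act_zpowD eij -act_zpowD addNr act1.
Qed.

Lemma orbit_escape a e (P : set E) : ~ periodic a e -> finite_set P ->
  exists N : nat, forall i, (N <= `|i|)%N -> ~ P (act (a ^^ i) e).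
Proof.
move=> nper fP; apply: (@finite_int_bound ((fun i => act (a ^^ i) e) @^-1` P)%classic).
by apply: finite_preimage => // i j _ _; apply: orbit_inj.
Qed.

Lemma periodic_orbit_finite a e :
  periodic a e -> finite_set [set act (a ^^ i) e | i in [set: int]]%classic.
Proof.
case=> k k0 fk; have fkm (m : int) : act (a ^^ (m * k)%R) e = e.
  elim/int_rect: m => [|n ih|n ih]; first by rewrite mul0r act1.
    by rewrite -addn1 PoszD mulrDl mul1r act_zpowD fk.
  have eN : act (a ^^ (- k)%R) e = e by rewrite zpowN -{1}fk actKV.
  have -> : (- Posz n.+1 * k = - Posz n * k + - k)%R by lia.
  by rewrite act_zpowD eN.
apply: (@sub_finite_set _ _ ((fun n : nat => act (a ^^ n) e) @` `I_`|k|)%classic).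
  move=> _ /= [i _ <-]; exists `|(i %% k)%Z|%N; first by rewrite /=; lia.
  rewrite /= gez0_abs ?modz_ge0; [|lia..].
  by rewrite [X in _ = act (a ^^ X) e](divz_eq i k) addrC [RHS]act_zpowD fkm.
exact: finite_image (finite_II _).
Qed.

Variable mu : E -> bool.
Hypothesis mu_almost : forall g, finite_set [set e | mu (act g e) != mu e]%classic.

(** The limit of [mu] at the positive end of the [a]-orbit, with default false. For almost invariant
    [mu] the limit can fail to exist only at periodic points. *)
Definition mulim a e : bool :=
  `[< exists N : nat, forall n, (N <= n)%N -> mu (act (a ^^ n) e) >].

Lemma mulim_act a i e : mulim a (act (a ^^ i) e) = mulim a e.
Proof.
have mono j x : mulim a x -> mulim a (act (a ^^ j) x).
  move=> /asboolP[N muN]; apply/asboolP; exists (N + `|j|)%N => n leNn.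
  rewrite -act_zpowD; have -> : (Posz n + j = `|(Posz n + j)%R|%N%:Z)%R by lia.
  by apply: muN; lia.
apply/idP/idP; last exact: mono.
by move/(mono (- i)%R); rewrite -act_zpowD addNr act1.
Qed.

Lemma mulim_eventually a e c N :
  (forall n, (N <= n)%N -> mu (act (a ^^ n) e) = c) -> mulim a e = c.
Proof.
move=> muc; apply/asboolP; case: c muc => muc; first by exists N.
case=> M muM; have := muM (maxn N M) (leq_maxr _ _).
by rewrite muc ?leq_maxl.
Qed.

(** A non-periodic orbit eventually leaves the finite set where [a] changes [mu], and is constant
    from then on. *)
Lemma mulimP a e : ~ periodic a e ->
  exists N : nat, forall n, (N <= n)%N -> mu (act (a ^^ n) e) = mulim a e.
Proof.
move=> nper; have [N muN] := orbit_escape nper (mu_almost a).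
have muc n : (N <= n)%N -> mu (act (a ^^ n) e) = mu (act (a ^^ N) e).
  elim: n => [|n ih]; first by rewrite leqn0 => /eqP->.
  rewrite leq_eqVlt => /orP[/eqP-> //|]; rewrite ltnS => leNn.
  rewrite -ih //; apply/eqP/negPn/negP => nmu; apply: (muN (Posz n)) => //=.
  by rewrite -actM -zpowS -PoszD addn1.
by exists N => n leNn; rewrite muc // (mulim_eventually muc).
Qed.

(** If [mu] differs from its limit at [e], it changes at some [p] of the finite set [D] further
    along the orbit. Behind each [p] there are finitely many such [e]: either the orbit is finite,
    or by symmetry the values far behind [p] equal the limit. *)
Lemma mulim_almost a :
  (forall e, ~ periodic a e -> exists N : nat, forall n, (N <= n)%N ->
     mu (act (a ^^ n) e) = mu (act (a ^^ (- n%:Z)%R) e)) ->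
  finite_set [set e | mulim a e != mu e]%classic.
Proof.
move=> sym; set D := [set e | mu (act a e) != mu e]%classic.
pose B p := [set e | mulim a e != mu e /\ exists n, e = act (a ^^ (- n%:Z)%R) p]%classic.
apply: (@sub_finite_set _ _ (\bigcup_(p in D) B p)%classic).
  move=> e /= nmu; apply: contrapT => nB.
  have step n : mu (act (a ^^ n.+1) e) = mu (act (a ^^ n) e).
    apply/eqP/negPn/negP => nstep; apply: nB; exists (act (a ^^ n) e).
      by rewrite /D /= -actM -zpowS -PoszD addn1.
    by split=> //; exists n; rewrite -act_zpowD addNr act1.
  have muc n : (0 <= n)%N -> mu (act (a ^^ n) e) = mu e.
    by elim: n => [|n ih] _; [rewrite act1|rewrite step ih].
  by rewrite (mulim_eventually muc) eqxx in nmu.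
apply: bigcup_finite => [|p _]; first exact: mu_almost.
have [per|nper] := EM (periodic a p).
  apply: sub_finite_set (periodic_orbit_finite per) => e [_ [n ->]].
  by exists (- n%:Z)%R.
have [[N muN] [M symM]] := (mulimP nper, sym p nper).
apply: (@sub_finite_set _ _
  ((fun n : nat => act (a ^^ (- n%:Z)%R) p) @` `I_(maxn N M))%classic).
  move=> e [nmu [n en]]; exists n => //=; rewrite ltnNge; apply/negP.
  rewrite geq_max => /andP[leNn leMn]; case/negP: nmu.
  by rewrite en mulim_act -symM // muN.
exact: finite_image (finite_II _).
Qed.

(* If b moves the a-orbit of e through infinitely many a-orbits, then mu is
   constant on one of its translates, and translating changes only finitely
   many values: so mu has the same limits at both ends of the a-orbit. *)
Lemma mu_two_ends a b e : a ** b = b ** a -> ~ periodic a e ->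
  (forall i j, act (a ^^ i ** b ^^ j) e = e -> j = 0%R) ->
  exists N : nat, forall n, (N <= n)%N ->
    mu (act (a ^^ n) e) = mu (act (a ^^ (- n%:Z)%R) e).
Proof.
move=> ab nper free.
have [j noD] : exists j : nat, forall i,
    mu (act a (act (a ^^ i ** b ^^ j) e)) = mu (act (a ^^ i ** b ^^ j) e).
  apply: contrapT => /forallNP D.
  have /choice[f fD] : forall j : nat, exists i,
      mu (act a (act (a ^^ i ** b ^^ j) e)) != mu (act (a ^^ i ** b ^^ j) e).
    by move=> j; have /existsNP[i /eqP Di] := D j; exists i.
  (* By [free] the points chosen for different [j] are distinct, so the finite set where [a] changes
     [mu] would be infinite. *)
  apply: infinite_nat.
  have -> : [set: nat]%classic = ((fun j : nat => act (a ^^ f j ** b ^^ j) e)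
      @^-1` [set e | mu (act a e) != mu e])%classic.
    by apply/seteqP; split=> j //= _; apply: fD.
  apply: finite_preimage (mu_almost a) => j j' _ _ ejj'.
  suff : (- Posz j' + Posz j = 0)%R by lia.
  apply: (free (- f j' + f j)%R); rewrite zpowD [b ^^ _]zpowD.
  rewrite -gmulA [a ^^ f j ** _]gmulA (zpow_comm2 _ _ ab) !gmulA.
  rewrite (zpow_comm2 _ _ ab) -!gmulA actM [act (_ ** (_ ** _)) e]actM ejj'.
  by rewrite !actM -!act_zpowD addNr act1 -act_zpowD addNr act1.
have muc i : mu (act (a ^^ i) (act (b ^^ j) e)) = mu (act (b ^^ j) e).
  have step k : mu (act (a ^^ (k + 1)%R) (act (b ^^ j) e)) =
                mu (act (a ^^ k) (act (b ^^ j) e)).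
    by rewrite zpowS actM -[act (a ^^ k) _]actM noD actM.
  elim/int_rect: i => [|n ih|n ih]; first by rewrite act1.
    by rewrite -addn1 PoszD step.
  by rewrite -step; have -> : (- Posz n.+1 + 1 = - Posz n)%R by lia.
(* Far out on the [a]-orbit of [e], applying [b ^^ j] no longer changes [mu], so the constant value
   on the translated orbit is taken there too. *)
have [N muN] := orbit_escape nper (mu_almost (b ^^ j)).
have mueq i : (N <= `|i|)%N -> mu (act (a ^^ i) e) = mu (act (b ^^ j) e).
  move=> leNi; rewrite -(muc i) (actC _ (zpow_comm2 i j ab)).
  by apply/eqP/negPn/negP; rewrite eq_sym; apply: muN.
by exists N => n leNn; rewrite !mueq ?abszN.
Qed.

End Action.

(** * Right-angled Artin groups *)

Definition int_group : group :=
  @Defs.Group int (fun x y => (x + y)%R) 0%R (fun x => (- x)%R)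
    (@addrA int) (@add0r int) (@addNr int).

Lemma int_group_zpow (x : int_group) i : x ^^ i = (i * (x : int))%R.
Proof.
elim/int_rect: i => [|n ih|n ih]; first by rewrite mul0r.
- by rewrite -addn1 PoszD zpowS ih mulrDl mul1r addrC.
- apply: (@gmul_injl int_group x); rewrite -zpowS.
  have -> : (- n.+1%:Z + 1 = - n%:Z)%R by lia.
  have -> : (- n.+1%:Z = -1 - n%:Z)%R by lia.
  by rewrite ih /= mulrDl mulN1r addrA subrr add0r.
Qed.

Lemma connect_ind (T : finType) (r : rel T) (P : T -> Prop) x y :
  connect r x y -> P x -> (forall a b, r a b -> P a -> P b) -> P y.
Proof.
case/connectP=> p; elim: p x => [|z p ih] x /=; first by move=> _ -> .
by case/andP=> rxz pz yE Px step; apply: (ih z) => //; apply: step rxz Px.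
Qed.

Section GraphConnectivity.
Variable Gm : simple_graph.

Lemma connected_on_neighbour (S : {set Gm}) x y :
  connected_on S -> x \in S -> y \in S -> x != y ->
  exists2 z, z \in S & gadj Gm x z.
Proof.
move=> conS Sx Sy nxy; case/connectP: (conS x y Sx Sy) => -[|z p] /=.
  by move=> _ exy; rewrite exy eqxx in nxy.
by case/andP=> /and3P[adj _ Sz] _ _; exists z.
Qed.

Lemma graph_third_vertex (x y : Gm) : 3 <= #|Gm| -> exists z : Gm, (z != x) && (z != y).
Proof.
move=> card3; have : 0 < #|~: [set x; y]|.
  by rewrite cardsCs finset.setCK subn_gt0 (leq_ltn_trans _ card3) // cards2; case: eqP.
by case/card_gt0P=> z; rewrite !inE negb_or; exists z.
Qed.

End GraphConnectivity.

Section RAAG.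
Variables (Gm : simple_graph) (G : group) (iota : Gm -> G).
Hypothesis raag : is_RAAG iota.

Lemma raag_comm v w : gadj Gm v w -> iota v ** iota w = iota w ** iota v.
Proof. by case: raag => comm _; apply: comm. Qed.

Lemma raag_lift (H : group) (f : Gm -> H) :
  (forall v w, gadj Gm v w -> f v ** f w = f w ** f v) ->
  exists2 g : G -> H, is_hom g & forall v, g (iota v) = f v.
Proof. by case: raag => _ up /up[g [hg gf _]]; exists g. Qed.

Lemma raag_hom_eq (H : group) (f g : G -> H) : is_hom f -> is_hom g ->
  (forall v, f (iota v) = g (iota v)) -> f =1 g.
Proof.
move=> hf hg fg x; case: raag => comm /(_ H (fun v => g (iota v)))[|k [_ _ uniqk]].
  by move=> v w adj; rewrite -!hg comm.
by rewrite (uniqk f) // (uniqk g).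
Qed.

Lemma raag_ind (P : G -> Prop) :
  subgroup P -> (forall v, P (iota v)) -> forall x, P x.
Proof.
move=> sP Pi.
have [|g hg gi] := @raag_lift (subg_group sP) (fun v => exist P (iota v) (Pi v)).
  by move=> v w adj; apply/eq_exist/raag_comm.
apply: (@subg_full _ _ sP g) => x.
apply: (@raag_hom_eq _ (fun x => of_subg (g x)) id) => // [y z|v]; last by rewrite gi.
by rewrite hg.
Qed.

(** The exponent sum of [v], a coordinate of the abelianization. *)
Lemma raag_exponent v : exists2 chi : G -> int_group, is_hom chi &
  forall u i, chi (iota u ^^ i) = (if u == v then i else 0)%R.
Proof.
have [|chi hchi chiv] := @raag_lift int_group (fun u => Posz (u == v)).
  by move=> *; apply: addrC.
exists chi => // u i; rewrite hom_zpow // int_group_zpow chiv.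
by case: eqP; rewrite ?mulr1 ?mulr0.
Qed.

(** A nonzero value at one power of [c] makes [chi c] nonzero, so [chi] kills only the zeroth power
    in the exponent of [y]. *)
Lemma hom_cyclic_trivial (chi : G -> int_group) c x y : is_hom chi ->
  (exists i, x = c ^^ i) -> (exists i, y = c ^^ i) ->
  chi x <> 0%R -> chi y = 0%R -> y = gone.
Proof.
move=> hchi [i ->] [j ->]; rewrite !hom_zpow // !int_group_zpow => nz /eqP.
rewrite mulf_eq0 => /orP[/eqP-> //|/eqP chic].
by case: nz; rewrite chic mulr0.
Qed.

(** * Correcting an almost invariant function when the graph is biconnected *)

Section Biconnected.
Hypotheses (card3 : 3 <= #|Gm|) (bic : biconnected Gm).

Lemma two_neighbours v :
  exists w w', [/\ gadj Gm v w, gadj Gm v w', w != v, w' != v & w' != w].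
Proof.
have nadj u : gadj Gm v u -> u != v.
  by move=> adj; apply/eqP=> uv; rewrite uv gadj_irr in adj.
have [u /andP[uv _]] := graph_third_vertex v v card3.
have [w _ vw] : exists2 w, w \in [set: Gm] & gadj Gm v w.
  by apply: (connected_on_neighbour bic.1 _ _ (y := u)); rewrite ?inE // eq_sym.
have [x /andP[xv xw]] := graph_third_vertex v w card3.
(* Deleting [w] leaves [v] and [x] in a connected graph, which yields a neighbour of [v] other than
   [w]. *)
have [w' w'w vw'] : exists2 w', w' \in [set~ w] & gadj Gm v w'.
  apply: (connected_on_neighbour (bic.2 w) _ _ (y := x)); rewrite ?inE //.
    by rewrite eq_sym nadj.
  by rewrite eq_sym.
by exists w, w'; split; rewrite ?nadj //; move: w'w; rewrite !inE.
Qed.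

Variables (E : Type) (act : G -> E -> E).
Hypothesis act1 : forall e, act gone e = e.
Hypothesis actM : forall g h e, act (g ** h) e = act g (act h e).
Hypothesis stab_cyclic :
  forall e, exists c, forall g, act g e = e -> exists i, g = c ^^ i.

Let per v e := periodic act (iota v) e.

(** Both powers lie in one cyclic group. The exponent of [v] is nonzero on the first and zero on the
    second, so the second would be trivial, against the infinite order of [iota w]. *)
Lemma periodic_unique v w e : per v e -> per w e -> v = w.
Proof.
move=> [i i0 fi] [j j0 fj]; apply/eqP/negPn/negP => nvw.
have [c cP] := stab_cyclic e; have [chi hchi chiE] := raag_exponent v.
have w1 : iota w ^^ j = gone.
  apply: (hom_cyclic_trivial hchi (cP _ fi) (cP _ fj)); rewrite chiE ?eqxx //.
  by rewrite eq_sym (negPf nvw).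
have [chi' hchi' chiE'] := raag_exponent w.
by apply: j0; have := chiE' w j; rewrite eqxx w1 hom1.
Qed.

(* Two elements v^i w^j and v^i' w'^j' of the cyclic stabilizer of e, with j
   and j' nonzero, would have proportional images in the abelianization. *)
Lemma free_neighbour v e : exists2 w, gadj Gm v w &
  forall i j, act (iota v ^^ i ** iota w ^^ j) e = e -> j = 0%R.
Proof.
have [w [w' [vw vw' wv w'v w'w]]] := two_neighbours v.
have [free|/existsNP[i /existsNP[j /not_implyP[fij j0]]]] :=
  EM (forall i j, act (iota v ^^ i ** iota w ^^ j) e = e -> j = 0%R).
  by exists w.
exists w' => // i' j' fij'; have [c cP] := stab_cyclic e.
have [chi hchi chiE] := raag_exponent w.
have v1 : iota v ^^ i' ** iota w' ^^ j' = gone.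
  apply: (hom_cyclic_trivial hchi (cP _ fij) (cP _ fij')); rewrite hchi !chiE.
    by rewrite eqxx eq_sym (negPf wv) /= add0r.
  by rewrite (negPf w'w) eq_sym (negPf wv) /= add0r.
have [chi' hchi' chiE'] := raag_exponent w'.
have := congr1 chi' v1; rewrite hchi' !chiE' hom1 // eqxx eq_sym (negPf w'v) /=.
by rewrite add0r.
Qed.

Variable mu : E -> bool.
Hypothesis mu_almost : forall g, finite_set [set e | mu (act g e) != mu e]%classic.

Let muv v := mulim act mu (iota v).

Lemma muv_almost v : finite_set [set e | muv v e != mu e]%classic.
Proof.
apply: mulim_almost => // e nper; have [w vw free] := free_neighbour v e.
exact: (mu_two_ends act1 actM mu_almost (raag_comm vw) nper free).
Qed.

Lemma muv_act v i e : muv v (act (iota v ^^ i) e) = muv v e.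
Proof. exact: mulim_act. Qed.

Lemma muv_almost_eq v w : finite_set [set e | muv v e != muv w e]%classic.
Proof.
apply: (@sub_finite_set _ _
  ([set e | muv v e != mu e] `|` [set e | muv w e != mu e])%classic).
  by move=> e /=; case: (muv v e) (muv w e) (mu e) => [] [] [] //=; auto.
by rewrite finite_setU; split; apply: muv_almost.
Qed.

(** Far along the [w]-orbits of [e] and of its translate, [muv w] coincides with [muv v], which is
    [v]-invariant; moving along a [w]-orbit does not change [muv w]. *)
Lemma muv_adj_act v w e i : gadj Gm v w -> ~ per w e ->
  muv w (act (iota v ^^ i) e) = muv w e.
Proof.
move=> vw nper; have comm := zpow_comm i (raag_comm vw).
have nper' : ~ per w (act (iota v ^^ i) e).
  by move/periodic_act => /(_ act1 actM (esym comm)).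
have [N PN] := orbit_escape act1 actM nper (muv_almost_eq v w).
have [M PM] := orbit_escape act1 actM nper' (muv_almost_eq v w).
set j := maxn N M.
rewrite -(muv_act w j e) -(muv_act w j (act _ e)).
have /negP/negPn/eqP <- := PN j (leq_maxl _ _).
have /negP/negPn/eqP <- := PM j (leq_maxr _ _).
by rewrite (actC actM _ (zpow_comm j (esym comm))) muv_act.
Qed.

Lemma muv_adj_eq v w e : gadj Gm v w -> ~ per v e -> ~ per w e ->
  muv v e = muv w e.
Proof.
move=> vw nv nw; have [N PN] := orbit_escape act1 actM nv (muv_almost_eq v w).
have /negP/negPn/eqP := PN N (leqnn _).
by rewrite muv_act muv_adj_act.
Qed.

(** At most one vertex [z] is periodic at [e]. The remaining vertices induce a connected graph,
    along whose edges equality propagates. *)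
Lemma muv_eq v w e : ~ per v e -> ~ per w e -> muv v e = muv w e.
Proof.
suff conn (S : {set Gm}) : connected_on S -> (forall u, u \in S -> ~ per u e) ->
    v \in S -> w \in S -> muv v e = muv w e.
  move=> nv nw; have [[z pz]|nz] := EM (exists z, per z e).
    have nzu u : ~ per u e -> u \in [set~ z].
      by move=> nu; rewrite !inE; apply/eqP=> uz; rewrite uz in nu.
    apply: (conn _ (bic.2 z)); [|exact: nzu..].
    by move=> u; rewrite !inE => /eqP nuz pu; apply/nuz/(periodic_unique pu pz).
  by apply: (conn _ bic.1); rewrite ?inE // => u _ pu; apply: nz; exists u.
move=> conS nS vS wS.
apply: (connect_ind (P := fun u => muv v e = muv u e) (conS v w vS wS)) => //.
by move=> a b /and3P[ab aS bS] ->; apply: muv_adj_eq => //; apply: nS.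
Qed.

Lemma almost_invariant_correction : exists nu : E -> bool,
  (forall g e, nu (act g e) = nu e) /\ finite_set [set e | nu e != mu e]%classic.
Proof.
have /card_gt0P[o _] : 0 < #|Gm| by apply: leq_trans card3.
have [o' /andP[o'o _]] := graph_third_vertex o o card3.
(* Since [o] and [o'] are never both periodic at [e], a vertex not periodic at [e] is always
   used. *)
pose nu e := if `[< per o e >] then muv o' e else muv o e.
have nuE v e : ~ per v e -> nu e = muv v e.
  move=> nv; rewrite /nu; case: asboolP => po; apply: muv_eq => // po'.
  by move/eqP: o'o; apply; apply: periodic_unique po' po.
exists nu; split; last first.
  apply: (@sub_finite_set _ _
    ([set e | muv o e != mu e] `|` [set e | muv o' e != mu e])%classic).
    by move=> e; rewrite /= /nu; case: asboolP; auto.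
  by rewrite finite_setU; split; apply: muv_almost.
apply: raag_ind => [|v e].
  split=> [e|x y ix iy e|x ix e]; first by rewrite act1.
    by rewrite actM ix iy.
  by rewrite -{2}(act1 e) -(gmulVr x) actM ix.
have perv u : gadj Gm v u \/ u = v -> per u (act (iota v) e) <-> per u e.
  move=> vu; apply: (periodic_act act1 actM).
  by case: vu => [/raag_comm/esym|->].
have [pv|nv] := EM (per v e); last first.
  have nv' : ~ per v (act (iota v) e) by move/perv; apply: contra_not nv; apply; right.
  by rewrite (nuE v) // (nuE v) // -{1}(zpow1 (iota v)) muv_act.
(* When [v] itself is periodic at [e], a neighbour [w] is not, and [muv w] is unchanged by [iota v]
   there. *)
have [w [_ [vw _ wv _ _]]] := two_neighbours v.
have nw : ~ per w e by move=> pw; move/eqP: wv; apply; apply: periodic_unique pw pv.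
have nw' : ~ per w (act (iota v) e) by move/perv; apply: contra_not nw; apply; left.
by rewrite (nuE w) // (nuE w) // -{1}(zpow1 (iota v)) muv_adj_act.
Qed.

End Biconnected.
End RAAG.

(** * The action on the cosets of a subgroup *)

Section CosetAction.
Variables (G : group) (C : G -> Prop) (sC : subgroup C).

Definition rcos (x : G) : G -> Prop := fun y => C (y ** x^V).
Definition coset_type := {P : G -> Prop | exists x, P = rcos x}.

Lemma rcos_actE g x : (fun y => rcos x (y ** g)) = rcos (x ** g^V).
Proof. by apply: funext => y; rewrite /rcos ginvM ginvK gmulA. Qed.

Definition mk_coset x : coset_type := exist _ (rcos x) (ex_intro _ x erefl).

Lemma coset_actP g (e : coset_type) :
  exists x, (fun y => sval e (y ** g)) = rcos x.
Proof. by case: (svalP e) => x ->; exists (x ** g^V); apply: rcos_actE. Qed.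

(** Sends the coset of [x] to that of [x ** g^V]; the inverse makes right translation a left
    action. *)
Definition coset_act g (e : coset_type) : coset_type := exist _ _ (coset_actP g e).

Lemma coset_act_mk g x : coset_act g (mk_coset x) = mk_coset (x ** g^V).
Proof. exact/eq_exist/rcos_actE. Qed.

Lemma mk_cosetP e : exists x, e = mk_coset x.
Proof. by case: e => P Px; have [x Pe] := Px; exists x; apply: eq_exist. Qed.

Lemma mk_coset_eq x y : mk_coset x = mk_coset y <-> C (x ** y^V).
Proof.
case: (sC) => C1 CM CV; split=> [[/(congr1 (@^~ x))]|Cxy].
  by rewrite /rcos gmulVr => <-.
apply: eq_exist; apply: funext => z; apply: propext; rewrite /rcos; split=> Cz.
  by rewrite -(gmulrKV x z) -gmulA; apply: CM.
rewrite -(gmulrKV y z) -gmulA; apply: CM => //.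
by rewrite -{1}[y]ginvK -ginvM; apply: CV.
Qed.

Lemma coset_act1 e : coset_act gone e = e.
Proof. by have [x ->] := mk_cosetP e; rewrite coset_act_mk ginv1 gmulr1. Qed.

Lemma coset_actM g h e : coset_act (g ** h) e = coset_act g (coset_act h e).
Proof. by have [x ->] := mk_cosetP e; rewrite !coset_act_mk ginvM gmulA. Qed.

(** The stabilizer of the coset of [x] is the conjugate of [C] by [x^V]. *)
Lemma coset_stab_cyclic : infinite_cyclic C ->
  forall e, exists c, forall g, coset_act g e = e -> exists i, g = c ^^ i.
Proof.
case=> c [Cc _] e; have [x ->] := mk_cosetP e.
exists (x^V ** c ** x) => g; rewrite coset_act_mk => /mk_coset_eq /Cc[i gi].
have conj_hom : is_hom (fun y : G => x^V ** y ** x).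
  by move=> y z; rewrite -!gmulA gmulK.
exists (- i)%R; rewrite -(hom_zpow _ _ conj_hom) zpowN -gi.
by rewrite !ginvM !ginvK -!gmulA gmulV gmulr1 gmulKV.
Qed.

(** Evaluates [phi] at a chosen representative, hence is meaningful only for [phi] invariant under
    left multiplication by [C]. *)
Definition coset_fun (phi : G -> bool) (e : coset_type) : bool :=
  phi (sval (cid (mk_cosetP e))).

Lemma coset_funE (phi : G -> bool) x :
  (forall c y, C c -> phi (c ** y) = phi y) -> coset_fun phi (mk_coset x) = phi x.
Proof.
move=> phiC; rewrite /coset_fun; case: cid => y /= /mk_coset_eq Cxy.
by rewrite -[in RHS](gmulrKV y x) phiC.
Qed.

End CosetAction.

(** Reduces almost invariance to generators: [mu] can change under a product only where one of the
    two successive moves changes it, and each move is injective. *)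
Lemma almost_invariant_subgroup (G : group) (E : Type) (act : G -> E -> E)
    (mu : E -> bool) :
  (forall e, act gone e = e) ->
  (forall g h e, act (g ** h) e = act g (act h e)) ->
  subgroup (fun g => finite_set [set e | mu (act g e) != mu e]%classic).
Proof.
move=> act1 actM.
have inj g : injective (act g).
  by move=> e e' /(congr1 (act g^V)); rewrite !(actKV act1 actM).
split=> [|g h fg fh|g fg].
- by apply: sub_finite_set (finite_set0 E) => e /=; rewrite act1 eqxx.
- apply: (@sub_finite_set _ _ ([set e | mu (act h e) != mu e] `|`
    act h @^-1` [set e | mu (act g e) != mu e])%classic).
    move=> e /=; rewrite actM.
    by case: (mu _) (mu _) (mu _) => [] [] [] //=; auto.
  rewrite finite_setU; split=> //; apply: finite_preimage => // x y _ _; exact: inj.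
- apply: (@sub_finite_set _ _
    (act g^V @^-1` [set e | mu (act g e) != mu e])%classic).
    by move=> e /=; rewrite -actM gmulVr act1 eq_sym.
  by apply: finite_preimage => // x y _ _; apply: inj.
Qed.

(** * Cocycles of splittings *)

(* The semidirect product of G with the functions G -> bool, on which G acts
   by right translation; sections G -> cocycle_group are cocycles. *)
Definition cocycle_group (G : group) : group.
Proof.
apply: (@Defs.Group ((G -> bool) * G)%type
  (fun p q => (fun x => p.1 x (+) q.1 (x ** p.2), p.2 ** q.2))
  (fun=> false, gone) (fun p => (fun x => p.1 (x ** p.2^V), p.2^V))).
- move=> p q r /=; congr pair; last exact: gmulA.
  by apply: funext => x; rewrite addbA gmulA.
- move=> [p g] /=; rewrite gmul1; congr pair.
  by apply: funext => x; rewrite gmulr1.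
- move=> [p g] /=; rewrite gmulV; congr pair.
  by apply: funext => x; rewrite addbb.
Defined.

Definition cocycle (G : group) (d : G -> G -> bool) :=
  forall g h x, d (g ** h) x = d g x (+) d h (x ** g).

Lemma section_cocycle (G : group) (s : G -> cocycle_group G) :
  is_hom s -> (forall g, (s g).2 = g) -> cocycle (fun g => (s g).1).
Proof. by move=> hs s2 g h x; rewrite hs /= s2. Qed.

Section Cocycle.
Variables (G : group) (d : G -> G -> bool) (dM : cocycle d).

Lemma cocycle1 x : d gone x = false.
Proof. by have := dM gone gone x; rewrite gmul1 gmulr1; case: (d _ _). Qed.

Lemma cocycleV g x : d g^V x = d g (x ** g^V).
Proof.
have := dM g^V g x; rewrite gmulV cocycle1.
by case: (d _ _) (d _ _) => [] [].
Qed.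

Lemma cocycle_invariant_subgroup (C : G -> Prop) :
  subgroup (fun g => forall c x, C c -> d g (c ** x) = d g x).
Proof.
split=> [c x _|g h ig ih c x Cc|g ig c x Cc]; first by rewrite !cocycle1.
- by rewrite !dM ig // -gmulA ih.
- by rewrite !cocycleV -gmulA ig.
Qed.

End Cocycle.

Section Amalgam.
Variables (G : group) (A B C : G -> Prop) (am : amalgam_of A B C).

Lemma amalgam_ind (P : G -> Prop) : subgroup P ->
  (forall x, A x -> P x) -> (forall x, B x -> P x) -> forall x, P x.
Proof.
case: am => sA [sB [sC [CAB up]]] sP AP BP.
have [|||g [hg gA gB _]] := up (subg_group sP) (to_subg sP) (to_subg sP).
- exact: to_subg_hom.
- exact: to_subg_hom.
- by [].
have [|||k [_ _ _ uniqk]] := up G id id => //.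
apply: (@subg_full _ _ sP g) => x.
rewrite (uniqk (fun x => of_subg (g x))).
- by rewrite -(uniqk id).
- by move=> y z; rewrite hg.
- by move=> a Aa; rewrite gA // to_subgK //; apply: AP.
- by move=> b Bb; rewrite gB // to_subgK //; apply: BP.
Qed.

(* In the Bass-Serre tree, d g x tells whether the edge with stabilizer C
   separates the vertices x A and x g A. *)
Lemma amalgam_cocycle : exists2 d : G -> G -> bool, cocycle d &
  (forall a x, A a -> d a x = false) /\
  (forall b x, B b -> d b x = `[<C x>] (+) `[<C (x ** b)>]).
Proof.
case: (am) => sA [sB [sC [CAB up]]].
(* The cocycle is zero on [A] and the coboundary of the indicator of [C] on [B]. The two agree on
   [C], as right multiplication by [C] preserves that indicator. *)
have [|||s [hs sA1 sB1 _]] := up (cocycle_group G) (fun a => (fun=> false, a))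
  (fun b => (fun x => `[<C x>] (+) `[<C (x ** b)>], b)).
- by [].
- move=> b b' _ _; congr pair; apply: funext => x.
  by rewrite gmulA addbA -[in RHS](addbA `[<C x>]) addbb addbF.
- move=> c Cc; congr pair; apply: funext => x.
  by rewrite (asbool_equiv_eq (subgroup_mulr x sC Cc)) addbb.
have s2 : forall g, (s g).2 = g.
  apply: amalgam_ind => [|a Aa|b Bb]; [|by rewrite sA1|by rewrite sB1].
  split=> [|g h eg eh|g eg]; first by rewrite (hom1 hs).
    by rewrite hs /= eg eh.
  by rewrite (homV _ hs) /= eg.
exists (fun g => (s g).1); first exact: section_cocycle.
by split=> g x Pg; [rewrite sA1|rewrite sB1].
Qed.

End Amalgam.

Section HNN.
Variables (G : group) (A C : G -> Prop) (t : G) (hnn : hnn_of A C t).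

Lemma hnn_ind (P : G -> Prop) : subgroup P ->
  (forall x, A x -> P x) -> P t -> forall x, P x.
Proof.
case: hnn => sA [sC [CA [CtA up]]] sP AP Pt.
have eqsub (p q : subg_group sP) : of_subg p = of_subg q -> p = q.
  by case: p q => p Pp [q Pq] /= epq; apply: eq_exist.
have [||g [hg gA gt _]] := up (subg_group sP) (to_subg sP) (to_subg sP t).
- exact: to_subg_hom.
- move=> c Cc; apply: eqsub; rewrite to_subgK; last exact/AP/CtA.
  by rewrite -[LHS]/(of_subg (to_subg sP t) **
    (of_subg (to_subg sP c) ** (of_subg (to_subg sP t))^V)) !to_subgK //; apply/AP/CA.
have [||k [_ _ _ uniqk]] := up G id t => //.
apply: (@subg_full _ _ sP g) => x.
rewrite (uniqk (fun x => of_subg (g x))).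
- by rewrite -(uniqk id).
- by move=> y z; rewrite hg.
- by move=> a Aa; rewrite gA // to_subgK //; apply: AP.
- by rewrite gt to_subgK.
Qed.

(** In the Bass-Serre tree the edge with stabilizer [C] joins the vertices [A] and [t^V A]; [d g x]
    tells whether it separates [x A] from [x g A]. *)
Lemma hnn_cocycle : exists2 d : G -> G -> bool, cocycle d &
  (forall a x, A a -> d a x = false) /\
  (forall x, d t x = `[<C (x ** t)>]).
Proof.
case: (hnn) => sA [sC [CA [CtA up]]].
have [||s [hs sA1 st _]] := up (cocycle_group G) (fun a => (fun=> false, a))
  (fun x => `[<C (x ** t)>], t).
- by [].
- move=> c Cc; congr pair; apply: funext => x /=.
  rewrite -!gmulA gmulV gmulr1 !gmulA.
  by rewrite (asbool_equiv_eq (subgroup_mulr (x ** t) sC Cc)) addbb.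
have s2 : forall g, (s g).2 = g.
  apply: hnn_ind => [|a Aa|]; [|by rewrite sA1|by rewrite st].
  split=> [|g h eg eh|g eg]; first by rewrite (hom1 hs).
    by rewrite hs /= eg eh.
  by rewrite (homV _ hs) /= eg.
exists (fun g => (s g).1); first exact: section_cocycle.
by split=> [g x Pg|x]; [rewrite sA1|rewrite st].
Qed.

Lemma hnn_exponent : exists2 eps : G -> int_group, is_hom eps &
  (forall a, A a -> eps a = 0%R) /\ eps t = 1%R.
Proof.
case: hnn => sA [sC [CA [CtA up]]].
have [||eps [heps epsA epst _]] := up int_group (fun=> 0%R) 1%R; last by exists eps.
- by move=> *; rewrite /= addr0.
- by move=> *; rewrite /= add0r subrr.
Qed.

End HNN.

(** * Biconnected graphs admit neither kind of splitting *)

Section NoSplitting.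
Variables (Gm : simple_graph) (G : group) (iota : Gm -> G).
Hypotheses (raag : is_RAAG iota) (card3 : 3 <= #|Gm|) (bic : biconnected Gm).

(* The powers of u false and u true show that coset_fun phi is neither finite
   nor cofinite. *)
Lemma no_two_sided_function (C : G -> Prop) (phi : G -> bool) (u : bool -> G) :
  subgroup C -> infinite_cyclic C ->
  (forall c x, C c -> phi (c ** x) = phi x) ->
  (forall g, finite_set
     [set e | coset_fun phi (coset_act g e) != @coset_fun _ C phi e]%classic) ->
  (forall b n, phi (npow (u b) n.+1) = b) ->
  (forall b n, ~ C (npow (u b) n.+1)) -> False.
Proof.
move=> sC cycC phiC phi_almost phiu nCu.
have [nu [nu_inv nu_almost]] := almost_invariant_correction raag card3 bic
  (@coset_act1 _ C) (@coset_actM _ C) (coset_stab_cyclic sC cycC) phi_almost.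
(* The action on cosets is transitive, so the invariant function [nu] is constant. *)
have nuE x : nu (mk_coset C x) = nu (mk_coset C gone).
  by rewrite -(nu_inv x^V (mk_coset C gone)) coset_act_mk ginvK gmul1.
(* With this choice [phi] disagrees with [nu] on all positive powers of [u b]. Their cosets are
   distinct, as otherwise some positive power would lie in [C]. *)
set b := ~~ nu (mk_coset C gone).
apply: infinite_nat.
have -> : [set: nat]%classic = ((fun n => mk_coset C (npow (u b) n.+1)) @^-1`
    [set e | nu e != coset_fun phi e])%classic.
  apply/seteqP; split=> n //= _; rewrite nuE (coset_funE sC) // phiu /b.
  by case: (nu _).
apply: finite_preimage nu_almost => m n _ _ /(mk_coset_eq sC).
rewrite -[npow _ m.+1]/(u b ^^ m.+1) -[npow _ n.+1]/(u b ^^ n.+1) -zpowN -zpowD.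
case emn: (_ - _)%R => [[|k]|k] Ck; first by lia.
  by case: (nCu b k).
by case: sC => _ _ CV; case: (nCu b k); rewrite -[npow _ _]ginvK; apply: CV.
Qed.

Section FromCocycle.
Variables (C : G -> Prop) (d : G -> G -> bool).
Hypotheses (sC : subgroup C) (cycC : infinite_cyclic C) (dM : cocycle d).
Hypothesis d_inv : forall g c x, C c -> d g (c ** x) = d g x.
Hypothesis dC : forall c x, C c -> d c x = false.

(** The side of the edge with stabilizer [C] on which the vertex [g A] lies, relative to [A]. *)
Let phi g := d g gone.

Lemma cocycle_phiM x g : phi (x ** g) = phi x (+) d g x.
Proof. by rewrite /phi dM gmul1. Qed.

Lemma cocycle_phiC c x : C c -> phi (c ** x) = phi x.
Proof. by move=> Cc; rewrite cocycle_phiM /phi dC // -[X in d x X]gmulr1 d_inv. Qed.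

Lemma cocycle_almost g (s : set (coset_type C)) : finite_set s ->
  (forall x, d g x -> s (mk_coset C x)) -> finite_set
     [set e | coset_fun phi (coset_act g e) != @coset_fun _ C phi e]%classic.
Proof.
move=> fs ds; have [_ _ inv] := almost_invariant_subgroup (coset_fun phi)
  (@coset_act1 _ C) (@coset_actM _ C).
(* The inverse of [g] moves the coset of [x] to that of [x ** g], where [phi] changes by [d g x]; so
   [g^V] is treated first. *)
rewrite -[g]ginvK; apply: inv; apply: sub_finite_set fs => e.
have [x ->] := mk_cosetP e; rewrite /= coset_act_mk ginvK.
rewrite !(coset_funE sC _ cocycle_phiC).
by rewrite cocycle_phiM => nphi; apply: ds; case: (d g x) (phi x) nphi => [] [].
Qed.

End FromCocycle.

(** The axis of [t] crosses the edge once, between [t^V A] and [A]. Hence [phi] is true on negative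
    powers of [t] and false on positive ones. *)
Lemma no_hnn_splitting (A C : G -> Prop) (t : G) :
  hnn_of A C t -> infinite_cyclic C -> False.
Proof.
move=> hnn cycC; have [sA [sC [CA _]]] := hnn.
have [d dM [dA dt]] := hnn_cocycle hnn.
have [eps heps [epsA epst]] := hnn_exponent hnn.
have dC c x : C c -> d c x = false by move=> /CA; apply: dA.
have d_inv : forall g c x, C c -> d g (c ** x) = d g x.
  apply: (hnn_ind hnn (cocycle_invariant_subgroup dM C)) => [a Aa c x _|c x Cc].
    by rewrite !dA.
  case: (sC) => _ CM CV; rewrite !dt; apply: asbool_equiv_eq; split=> Cxt.
    by rewrite -(gmulKV c (x ** t)) [c ** _]gmulA; apply: CM => //; apply: CV.
  by rewrite -gmulA; apply: CM.
have nC i : i <> 0%R -> ~ C (t ^^ i).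
  move=> i0 /CA /epsA; rewrite hom_zpow // int_group_zpow epst mulr1.
  exact: i0.
have nCn n : ~ C (npow t n.+1) by apply: (nC n.+1).
have nCV n : ~ C (npow t^V n.+1).
  have -> : npow t^V n.+1 = t ^^ (- n.+1%:Z)%R; last by apply: nC; lia.
  elim: n => [|n ih]; first by rewrite zpowN zpow1 /= gmulr1.
  rewrite npowSr ih -{2}(zpow1 t) -zpowN -zpowD.
  by congr (_ ^^ _); lia.
apply: (@no_two_sided_function C (fun g => d g gone)
  (fun b => if b then t^V else t)) => //.
- by move=> c x Cc; apply: (cocycle_phiC dM d_inv dC).
- have almost := cocycle_almost sC dM d_inv dC.
  apply: (hnn_ind hnn (almost_invariant_subgroup _ (@coset_act1 _ C)
    (@coset_actM _ C))) => [a Aa|].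
    by apply: (almost _ _ (finite_set0 _)) => x; rewrite dA.
  apply: (almost _ _ (finite_set1 (mk_coset C t^V))) => x; rewrite dt => /asboolP Cxt.
  by apply/(mk_coset_eq sC); rewrite ginvK.
- case=> n.
    elim: n => [|n ih].
      rewrite /= gmulr1 (cocycleV dM) gmul1 dt gmulV.
      by apply/asboolP; case: sC.
    rewrite npowSr (cocycle_phiM dM) ih (cocycleV dM) dt gmulrKV.
    by case: asboolP => // /nCV.
  elim: n => [|n ih]; first by rewrite /= gmulr1 dt gmul1;
    apply/asboolP; move: (nCn 0%N); rewrite /= gmulr1.
  rewrite npowSr (cocycle_phiM dM) ih dt -npowSr.
  by case: asboolP => // /nCn.
- by case.
Qed.

(** Take [a] in [A] and [b] in [B], both outside [C]. On alternating words [phi] detects the first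
    letter, so the powers of [a ** b] and of [b ** a] lie on different sides. *)
Lemma no_amalgam_splitting (A B C : G -> Prop) :
  amalgam_of A B C -> infinite_cyclic C ->
  ~ (forall x, A x -> C x) -> ~ (forall x, B x -> C x) -> False.
Proof.
move=> am cycC /existsNP[a /not_implyP[Aa nCa]] /existsNP[b /not_implyP[Bb nCb]].
have [sA [sB [sC [CAB _]]]] := am.
have CA x : C x -> A x by case/CAB.
have CB x : C x -> B x by case/CAB.
have [C1 CM CV] := sC.
have [d dM [dA dB]] := amalgam_cocycle am.
have dC c x : C c -> d c x = false by move=> /CA; apply: dA.
have Cl c x : C c -> C (c ** x) <-> C x.
  move=> Cc; split=> [Ccx|]; last exact: CM.
  by rewrite -(gmulKV c x); apply: CM => //; apply: CV.
have d_inv : forall g c x, C c -> d g (c ** x) = d g x.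
  apply: (amalgam_ind am (cocycle_invariant_subgroup dM C)) => [x Ax c y _|x Bx c y Cc].
    by rewrite !dA.
  rewrite !dB // -gmulA.
  by rewrite (asbool_equiv_eq (Cl c y Cc)) (asbool_equiv_eq (Cl c (y ** x) Cc)).
pose letter s := if s then a else b.
pose word := fix word (s : bool) n :=
  if n is m.+1 then letter s ** word (~~ s) m else gone.
have wordSr s n : word s n.+1 = word s n ** letter (s (+) odd n).
  elim: n s => [|n ih] s; first by rewrite /= gmul1 gmulr1 addbF.
  by rewrite -[LHS]/(letter s ** word (~~ s) n.+1) ih gmulA /=;
    congr (_ ** letter _); case: s (odd n) => [] [].
have word_reduced n : forall s, ~ C (word s n.+1) /\ d (word s n.+1) gone = ~~ s.
  elim: n => [|n ih] s.
    rewrite /= gmulr1; case: s => /=; first by rewrite dA.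
    by split=> //; rewrite dB // gmul1 asboolT // asboolF.
  have nCw : ~ C (word s n.+2).
    rewrite -[word s n.+2]/(letter s ** word (~~ s) n.+1).
    have [nCw' phiw'] := ih (~~ s).
    case: s nCw' phiw' => /= nCw' phiw' Cw.
      have Aw' : A (word false n.+1).
        by rewrite -(gmulKV a (word _ _)); case: sA => _ AM AV; apply: AM; [apply: AV|apply: CA].
      by rewrite dA in phiw'.
    have Bw' : B (word true n.+1).
      by rewrite -(gmulKV b (word _ _)); case: sB => _ BM BV; apply: BM; [apply: BV|apply: CB].
    by move: phiw'; rewrite dB // gmul1 asboolT // asboolF.
  split=> //; have [nCw' phiw'] := ih s.
  (* Appending a last letter keeps [phi]: the cocycle is zero on [a], and on [b] it compares two
     words that both lie outside [C]. *)
  move: nCw; rewrite wordSr (cocycle_phiM dM) phiw' /letter; case: (_ (+) odd _) => nCw.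
    by rewrite dA // addbF.
  by rewrite dB // !asboolF //= addbF.
have word_npow s n : npow (word s 2) n = word s n.*2.
  elim: n => //= n ->; rewrite -gmulA; congr (_ ** _).
  by rewrite -gmulA gmul1 negbK.
apply: (@no_two_sided_function C (fun g => d g gone) (fun s => word (~~ s) 2)) => //.
- by move=> c x Cc; apply: (cocycle_phiC dM d_inv dC).
- have almost := cocycle_almost sC dM d_inv dC.
  apply: (amalgam_ind am (almost_invariant_subgroup _ (@coset_act1 _ C)
    (@coset_actM _ C))) => [x Ax|x Bx].
    by apply: (almost _ _ (finite_set0 _)) => y; rewrite dA.
  (* For [x] in [B] the cocycle [d x] is supported on two cosets at most. *)
  apply: (almost _ [set mk_coset C gone; mk_coset C x^V]%classic) => [|y].
    by rewrite finite_setU; split; apply: finite_set1.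
  rewrite dB //; case: asboolP => [Cy _|_]; last case: asboolP => // Cyx _.
    by left; apply/(mk_coset_eq sC); rewrite ginv1 gmulr1.
  by right; apply/(mk_coset_eq sC); rewrite ginvK.
- by move=> s n; rewrite word_npow doubleS (word_reduced _ _).2 negbK.
- by move=> s n; rewrite word_npow doubleS; apply: (word_reduced _ _).1.
Qed.

End NoSplitting.

(** * Splittings from cut vertices *)

(** The factors are generated by [S] together with [v], and by the complement of [S]. Every edge
    lies inside one of these vertex sets, so compatible maps on the factors glue through the
    universal property of the Artin group. *)
Lemma cut_vertex_splits (Gm : simple_graph) (G : group) (iota : Gm -> G)
    (v s t : Gm) (S : {set Gm}) : is_RAAG iota ->
  v \notin S -> s \in S -> t \notin S -> t != v ->
  (forall x y, gadj Gm x y -> x \in S -> y \notin S -> y = v) ->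
  splits_over_Z G.
Proof.
move=> raag vS sS tS tv cut; left.
pose PA g := exists2 u, (u \in S) || (u == v) & g = iota u.
pose PB g := exists2 u, u \notin S & g = iota u.
pose C g := exists i, g = iota v ^^ i.
have sA := gen_subgroup PA; have sB := gen_subgroup PB.
have PAi u : (u \in S) || (u == v) -> gen PA (iota u).
  by move=> Su; apply: gen_sub; exists u.
have PBi u : u \notin S -> gen PB (iota u).
  by move=> Su; apply: gen_sub; exists u.
have vA : (v \in S) || (v == v) by rewrite eqxx orbT.
(* The exponent of [u] is 1 on [iota u] and 0 on every power of [iota v]. *)
have nC u : u != v -> ~ C (iota u).
  move=> uv [i ui]; have [chi hchi chiE] := raag_exponent raag u.
  have := chiE u 1%R; rewrite eqxx zpow1 ui chiE.
  by rewrite eq_sym (negPf uv).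
exists (gen PA), (gen PB), C; split; last 1 first.
- by move=> BC; apply: (nC t tv (BC _ (PBi t tS))).
- split=> //; split=> //; split; last split.
  + split=> [|x y [i ->] [j ->]|x [i ->]]; first by exists 0%R.
      by exists (i + j)%R; rewrite zpowD.
    by exists (- i)%R; rewrite zpowN.
  + by move=> x [i ->]; split; [apply: (subgroup_zpow _ sA (PAi v vA))|
      apply: (subgroup_zpow _ sB (PBi v vS))].
  move=> H fA fB hA hB fAB.
  have fv : fA (iota v) = fB (iota v) by apply: fAB; exists 1%R; rewrite zpow1.
  pose f u := if u \in S then fA (iota u) else fB (iota u).
  have fAE u : (u \in S) || (u == v) -> f u = fA (iota u).
    by rewrite /f; case: ifP => //= _ /eqP->.
  have fBE u : u \notin S -> f u = fB (iota u) by rewrite /f => /negPf->.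
  have [|g hg gf] := raag_lift raag (f := f).
    move=> x y adj; have comm := raag_comm raag adj.
    have inA : (x \in S) || (x == v) -> (y \in S) || (y == v) ->
        f x ** f y = f y ** f x.
      by move=> Ax Ay; rewrite !fAE // -!hA ?comm //; apply: PAi.
    have [xS|xS] := boolP (x \in S); have [yS|yS] := boolP (y \in S).
    - by apply: inA; rewrite ?xS ?yS.
    - by apply: inA; rewrite ?xS // (cut x y) // eqxx orbT.
    - by apply: inA; rewrite ?yS // (cut y x) ?eqxx ?orbT // gadj_sym.
    - by rewrite !fBE // -!hB ?comm //; apply: PBi.
  exists g; split=> //.
  + apply: (hom_on_eq sA hA hg (P := PA)) => // [x Px|x [u Su ->]].
      exact: gen_sub.
    by rewrite gf fAE.
  + apply: (hom_on_eq sB hB hg (P := PB)) => // [x Px|x [u Su ->]].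
      exact: gen_sub.
    by rewrite gf fBE.
  + move=> g' hg' g'A g'B; apply: (raag_hom_eq raag hg' hg) => u; rewrite gf.
    have [Su|Su] := boolP (u \in S).
      by rewrite fAE ?Su // g'A //; apply: PAi; rewrite Su.
    by rewrite fBE // g'B //; apply: PBi.
- exists (iota v); split=> // i vi.
  have [chi hchi chiE] := raag_exponent raag v.
  by have := chiE v i; rewrite eqxx vi hom1.
- move=> AC; apply: (nC s); first by apply: contraNneq vS => <-.
  by apply: (AC _ (PAi s _)); rewrite sS.
Qed.

Lemma not_biconnected_cut (Gm : simple_graph) : 3 <= #|Gm| -> ~ biconnected Gm ->
  exists v : Gm, ~ connected_on [set~ v].
Proof.
move=> card3 nbic; apply: contrapT => /forallNP conn; apply: nbic.
have conn' (v : Gm) : connected_on [set~ v] by apply: contrapT; apply: conn.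
(* Connectedness of the whole graph follows by joining [x] to [y] in the complement of a third
   vertex. *)
split=> // x y _ _; have [z /andP[zx zy]] := graph_third_vertex x y card3.
apply: (@connect_sub _ (fun a b => [&& gadj Gm a b, a \in [set~ z] & b \in [set~ z]])).
  by move=> a b /and3P[ab _ _]; apply: connect1; rewrite /= ab !inE.
by apply: conn'; rewrite !inE eq_sym.
Qed.

Theorem theoremA (Gm : simple_graph) (G : group) (iota : Gm -> G) :
  3 <= #|Gm| -> is_RAAG iota ->
  (biconnected Gm <-> ~ splits_over_Z G).
Proof.
move=> card3 raag; split=> [bic|nsplit].
  case=> [[A [B [C [am cycC nAC nBC]]]]|[A [C [t [hnn cycC]]]]].
    exact: (no_amalgam_splitting raag card3 bic am cycC nAC nBC).
  exact: (no_hnn_splitting raag card3 bic hnn cycC).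
apply: contrapT => /(not_biconnected_cut card3)[v nconn]; apply: nsplit.
case/existsNP: nconn => x /existsNP[y /not_implyP[xv /not_implyP[yv nxy]]].
pose e a b := [&& gadj Gm a b, a \in [set~ v] & b \in [set~ v]].
(* The set [S] is the component of [x] in the graph without [v]; an edge leaving it can only end at
   [v]. *)
apply: (@cut_vertex_splits Gm G iota v x y [set z in [set~ v] | connect e x z]) => //.
- by rewrite !inE eqxx.
- by rewrite inE xv connect0.
- by rewrite inE yv; apply/negP.
- by move: yv; rewrite !inE.
move=> a b ab; rewrite !inE => /andP[av xa] nb; apply/eqP/negPn/negP => bv.
move: nb; rewrite bv (connect_trans xa) //.
by apply: connect1; rewrite /e ab !inE av.
Qed.
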